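(* Let $\widehat a(z)$ be a polynomial of degree $n$ with real coefficients, relatively prime with $\widehat a(-z)$, and such that $\widehat a(1)=2$ and $\widehat a(-1)=0$. For $\star\in\{+,-\}$ and $1\le i\le n$ let $p_i^\star(z)$ be the unique polynomial of degree less than $n$ with $$\widehat a(z)\,p_i^\star(z)\ \star\ \widehat a(-z)\,p_i^\star(-z)=2\,z^{2i-\ell^\star},$$ where $\ell^+=2$ and $\ell^-=1$. Then, for each $\star\in\{+,-\}$ and $1\le i\le n$, the Laurent polynomial $$m_i^\star(z):=\frac{\widehat a(z)\,p_i^\star(z)}{z^{2i-\ell^\star}}$$ is an interpolatory symbol, i.e. $m_i^\star(z)+m_i^\star(-z)=2$, and it satisfies $m_i^\star(1)=2$ and $m_i^\star(-1)=0$.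
   Context: For $\star\in\{+,-\}$, the expression $A\star B$ means $A+B$ if $\star=+$ and $A-B$ if $\star=-$. A Laurent polynomial $m(z)$ is called an interpolatory symbol if $m(z)+m(-z)=2$ (equivalently, its coefficient of $z^0$ is $1$ and all other coefficients of even powers of $z$ vanish). *)

(* Defs.v *)
From HB Require Import structures.
From mathcomp Require Import all_boot all_order all_algebra.
From mathcomp Require Import finmap monalg.
From mathcomp Require Import reals.

Set Implicit Arguments.
Unset Strict Implicit.
Unset Printing Implicit Defensive.

Import Order.TTheory GRing.Theory Num.Theory.

Local Open Scope ring_scope.

Inductive sign := Plus | Minus.

Definition star (V : zmodType) (s : sign) (A B : V) : V :=
  match s with Plus => A + B | Minus => A - B end.

Definition ell (s : sign) : nat := match s with Plus => 2 | Minus => 1 end.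

Section Laurent.
Variable R : realType.

(* A Laurent polynomial is a finitely supported family of coefficients indexed
   by int: m@_k is the coefficient of z^k and lmonom c k is c z^k.  The
   library makes {malg R[int]} a zmodType; its ring structure requires the
   exponents to form a monoid without nontrivial units, which excludes int. *)
Local Notation laurent := {malg R[int]}.

Definition lmonom (c : R) (k : int) : laurent := << c *g k >>.

Definition laurent_of_poly (p : {poly R}) : laurent :=
  \sum_(k < size p) lmonom p`_k k.

Definition ldivXn (m : laurent) (d : nat) : laurent :=
  \sum_(k <- msupp m) lmonom m@_k (k - Posz d).

(* m(-z) *)
Definition lneg (m : laurent) : laurent :=
  \sum_(k <- msupp m) lmonom (m@_k * (-1) ^ k) k.

(* m(x); meaningful only for x != 0, since MathComp sets 0^-1 = 0. *)
Definition leval (m : laurent) (x : R) : R :=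
  \sum_(k <- msupp m) m@_k * x ^ k.

Definition interpolatory_symbol (m : laurent) : Prop :=
  m + lneg m = lmonom 2 0.

(* p(-z) *)
Definition pneg (p : {poly R}) : {poly R} := p \Po (- 'X).

(* The degree condition reads size p <= n because size is degree + 1, with
   size 0 = 0.  For 1 <= i the subtraction 2 * i - ell s is not truncated. *)
Definition is_bezout_poly (a : {poly R}) (n : nat) (s : sign) (i : nat)
    (p : {poly R}) : Prop :=
  (size p <= n)%N /\
  star s (a * p) (pneg a * pneg p) = 2%:P * 'X^(2 * i - ell s).

Definition symbol (a p : {poly R}) (s : sign) (i : nat) : laurent :=
  ldivXn (laurent_of_poly (a * p)) (2 * i - ell s).

End Laurent.

(* Main.v *)
Require Import Defs.
From mathcomp Require Import all_boot all_order all_algebra.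
From mathcomp Require Import finmap monalg.
From mathcomp Require Import reals.
From mathcomp Require Import zify ring.
Local Open Scope ring_scope.

(** Put [b(z) = a(-z)] and let [e] be [1] or [-1] according to the sign, so
    that the equation reads [a p + e b p(-z) = f] with [f = 2 z^d].  The
    exponent [d] has the parity that makes [f(-z) = e f(z)].

    Existence.  The polynomials [a] and [b] are coprime of degree [n] and [f]
    has degree below [2n], so [a u + b v = f] has exactly one solution with
    [u] and [v] of degree below [n] ([bezout_small], [bezout_small_inj]).
    Replacing [z] by [-z] in this equation exchanges [a] and [b] and multiplies
    [f] by [e]; hence [(e v(-z), e u(-z))] is another such solution, and
    uniqueness of the pair forces [v = e u(-z)].  So [p = u] solves the
    equation, and uniqueness of [p] is uniqueness of the pair [(p, e p(-z))].

    Interpolation.  Write [q = a p], so [m = q / z^d].  Comparing coefficients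
    of [z^j] in [q + e q(-z) = 2 z^d] gives [q_j (1 + (-1)^(j-d)) = 2] if
    [j = d] and [0] otherwise, which is [m(z) + m(-z) = 2] coefficient by
    coefficient.  Finally [q(-1) = 0] since [a(-1) = 0], so evaluating
    the equation for [q] at [1] leaves [q(1) = 2]; dividing by [z^d]
    changes these values only by powers of [1] and [-1]. *)

Import Order.TTheory GRing.Theory Num.Theory.

Set Implicit Arguments.
Unset Strict Implicit.
Unset Printing Implicit Defensive.

(** * The substitution z := -z on polynomials *)

Lemma coef_pneg (R : realType) (p : {poly R}) (j : nat) :
  (pneg p)`_j = (-1) ^+ j * p`_j.
Proof.
rewrite /pneg coef_comp_poly.
under eq_bigr => k _ do rewrite -scaleN1r exprZn coefZ coefXn.
case: (ltnP j (size p)) => [ltj|gej].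
  rewrite (bigD1 (Ordinal ltj)) //= eqxx mulr1 big1 ?addr0; first exact: mulrC.
  move=> k nek; case: eqP => [ejk|]; last by rewrite !mulr0.
  by case/eqP: nek; apply: val_inj.
rewrite nth_default // mulr0 big1 // => k _.
by case: eqP => [ejk|]; [have := ltn_ord k; lia | rewrite !mulr0].
Qed.

Lemma size_pneg (R : realType) (p : {poly R}) : size (pneg p) = size p.
Proof. by rewrite size_comp_poly2 // size_polyN size_polyX. Qed.

Lemma pnegK (R : realType) : involutive (@pneg R).
Proof.
by move=> p; rewrite /pneg -comp_polyA raddfN /= comp_polyX opprK comp_polyXr.
Qed.

Lemma pnegM (R : realType) (p q : {poly R}) : pneg (p * q) = pneg p * pneg q.
Proof. exact: comp_polyM. Qed.

Lemma pnegD (R : realType) (p q : {poly R}) : pneg (p + q) = pneg p + pneg q.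
Proof. exact: comp_polyD. Qed.

Lemma pnegZ (R : realType) (c : R) (p : {poly R}) : pneg (c *: p) = c *: pneg p.
Proof. exact: comp_polyZ. Qed.

Lemma pneg_Xn (R : realType) (d : nat) :
  pneg ('X^d : {poly R}) = (-1) ^+ d *: 'X^d.
Proof. by rewrite /pneg comp_Xn_poly -scaleN1r exprZn. Qed.

Lemma horner_pneg (R : realType) (p : {poly R}) (x : R) :
  (pneg p).[x] = p.[- x].
Proof. by rewrite /pneg horner_comp hornerN hornerX. Qed.

(** * Coprime polynomials *)

(** The difference of the two first cofactors is a multiple of [b], by
    coprimality, and has smaller degree than [b]. *)
Lemma bezout_small_inj (R : fieldType) (n : nat) (a b u v u' v' : {poly R}) :
    size a = n.+1 -> size b = n.+1 -> coprimep a b ->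
    (size u <= n)%N -> (size u' <= n)%N -> a * u + b * v = a * u' + b * v' ->
  u = u' /\ v = v'.
Proof.
move=> sa sb co su su' /eqP eq_uv.
have {}eq_uv: a * (u - u') = b * (v' - v).
  by move: eq_uv; rewrite -subr_eq0 => /eqP eq0; apply/eqP;
    rewrite -subr_eq0 -eq0; apply/eqP; ring.
have nz_b: b != 0 by rewrite -size_poly_eq0 sb.
have u_eq: u - u' = 0.
  apply/eqP; apply: contraTT isT => nz.
  have: b %| u - u'.
    by rewrite -(@Gauss_dvdpr _ (u - u') a b) 1?coprimep_sym // eq_uv dvdp_mulr.
  move/(dvdp_leq nz); rewrite sb leqNgt ltnS.
  by rewrite (leq_trans (size_polyD _ _)) // size_polyN geq_max su.
split; first exact/subr0_eq.
move/eqP: eq_uv; rewrite u_eq mulr0 eq_sym mulf_eq0 (negPf nz_b) /=.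
by move/eqP/subr0_eq.
Qed.

(** Reducing the first Bezout cofactor modulo [b] bounds its degree; the degree
    of [f] then bounds the second one. *)
Lemma bezout_small (R : fieldType) (n : nat) (a b f : {poly R}) :
    size a = n.+1 -> size b = n.+1 -> coprimep a b -> (size f <= n + n)%N ->
  exists u v : {poly R},
    [/\ (size u <= n)%N, (size v <= n)%N & a * u + b * v = f].
Proof.
move=> sa sb /Bezout_eq1_coprimepP[[u0 v0] /= uv1] sf.
have nz_b: b != 0 by rewrite -size_poly_eq0 sb.
pose u := (f * u0) %% b; pose v := f * v0 + a * ((f * u0) %/ b).
have su: (size u <= n)%N by rewrite -ltnS -sb ltn_modp.
have fE: a * u + b * v = f.
  have := divp_eq (f * u0) b; rewrite -/u => fu.
  have ->: a * u + b * v = a * ((f * u0) %/ b * b + u) + b * (f * v0).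
    by rewrite /v; ring.
  by rewrite -fu -[RHS]mulr1 -uv1; ring.
exists u, v; split=> //.
have [->|nz_v] := eqVneq v 0; first by rewrite size_poly0.
have: (size (b * v)%R <= n + n)%N.
  have ->: b * v = f - a * u by rewrite -fE; ring.
  rewrite (leq_trans (size_polyD _ _)) // size_polyN geq_max sf.
  by rewrite (leq_trans (size_polyMleq _ _)) // sa addSn leq_add2l.
by rewrite size_mul // sb addSn leq_add2l.
Qed.

(** * Existence and uniqueness of the complementary factor *)

Lemma star_ell (R : realType) (s : sign) (p q : {poly R}) :
  star s p q = p + (-1) ^+ ell s *: q.
Proof. by case: s; rewrite /= ?sqrrN ?expr1n ?expr1 ?scale1r ?scaleN1r. Qed.

(** The sign in the equation is thus the factor by which its right-hand side
    is multiplied under [z := -z]. *)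
Lemma sign_exponent (R : realType) (s : sign) (i : nat) : (1 <= i)%N ->
  (-1) ^+ (2 * i - ell s) = (-1) ^+ ell s :> R.
Proof.
move=> i1; rewrite -signr_odd -[RHS]signr_odd.
by congr (_ ^+ nat_of_bool _); case: s => /=; lia.
Qed.

Lemma is_bezout_poly_unique (R : realType) (n : nat) (a : {poly R}) (s : sign)
    (i : nat) (p q : {poly R}) :
    size a = n.+1 -> coprimep a (pneg a) ->
    is_bezout_poly a n s i p -> is_bezout_poly a n s i q -> p = q.
Proof.
move=> sa co [sp ep] [sq]; rewrite -ep !star_ell !scalerAr => /esym eq_pq.
by have [] := bezout_small_inj sa (etrans (size_pneg a) sa) co sp sq eq_pq.
Qed.

Lemma is_bezout_poly_exists (R : realType) (n : nat) (a : {poly R}) (s : sign)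
    (i : nat) :
    size a = n.+1 -> coprimep a (pneg a) -> (1 <= i <= n)%N ->
  exists p, is_bezout_poly a n s i p.
Proof.
move=> sa co /andP[i1 le_in].
set d := (2 * i - ell s)%N; set e : R := (-1) ^+ ell s.
have sb: size (pneg a) = n.+1 by rewrite size_pneg.
have sf: (size (2%:P * 'X^d : {poly R})%R <= n + n)%N.
  rewrite mul_polyC (leq_trans (size_scale_leq _ _)) // size_polyXn /d.
  by case: s @d @e => /=; lia.
have [u [v [su sv uvE]]] := bezout_small sa sb co sf.
have ee: e * e = 1 by rewrite -expr2 sqrr_sign.
(* The image of the equation under [z := -z], multiplied by [e]. *)
have flip: a * (e *: pneg v) + pneg a * (e *: pneg u) = a * u + pneg a * v.
  have: pneg (a * u + pneg a * v) = e *: (2%:P * 'X^d).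
    by rewrite uvE mul_polyC pnegZ pneg_Xn sign_exponent // !scalerA mulrC.
  rewrite pnegD !pnegM pnegK uvE => eqf.
  by rewrite -!scalerAr -scalerDr addrC eqf scalerA ee scale1r.
have seu: (size (e *: pneg v) <= n)%N.
  by rewrite (leq_trans (size_scale_leq _ _)) // size_pneg.
have [_ vE] := bezout_small_inj sa sb co seu su flip.
by exists u; split=> //; rewrite star_ell scalerAr vE.
Qed.

(** * Laurent polynomials as sums of monomials *)

(** Shift, substitution and evaluation of Laurent polynomials all have the form
    of this sum with [F] additive in the coefficient, so this lemma lets each
    be computed on any expression as a sum of monomials, where exponents may
    repeat and coefficients may vanish. *)
Lemma sum_msupp_lmonom (R : realType) (V : zmodType) (F : R -> int -> V)
    (N : nat) (c : nat -> R) (k : nat -> int) :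
    (forall x y j, F (x + y) j = F x j + F y j) ->
    let m := \sum_(j < N) lmonom (c j) (k j) in
  \sum_(j <- msupp m) F m@_j j = \sum_(j < N) F (c j) (k j).
Proof.
move=> FD /=.
have F0 j : F 0 j = 0 by apply: (addrI (F 0 j)); rewrite -FD !addr0.
have widen (D : {fset int}) (m : {malg R[int]}) : (msupp m `<=` D)%fset ->
    \sum_(j <- msupp m) F m@_j j = \sum_(j <- D) F m@_j j.
  by move=> sD; apply: big_fset_incl => // j _ /mcoeff_outdom ->.
elim: N => [|N IHN]; first by rewrite !big_ord0 msupp0 big_seq_fset0.
rewrite !big_ord_recr /= -IHN; set m := \sum_(j < N) _; set w := lmonom _ _.
pose D := (msupp m `|` msupp w)%fset.
have ->: F (c N) (k N) = \sum_(j <- msupp w) F w@_j j.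
  rewrite (widen [fset k N]%fset) ?msuppU_le //.
  by rewrite big_seq_fset1 mcoeffUU.
rewrite (widen D (m + w)) ?msuppD_le // (widen D m) ?fsubsetUl //.
rewrite (widen D w) ?fsubsetUr // -big_split.
by apply: eq_bigr => j _; rewrite mcoeffD FD.
Qed.

Lemma lmonomD (R : realType) (x y : R) (k : int) :
  lmonom (x + y) k = lmonom x k + lmonom y k.
Proof. exact: monalgUD. Qed.

Lemma ldivXn_laurent_of_poly (R : realType) (q : {poly R}) (d : nat) :
  ldivXn (laurent_of_poly q) d =
    \sum_(j < size q) lmonom q`_j (Posz j - Posz d).
Proof.
exact: (@sum_msupp_lmonom R _ (fun x k => lmonom x (k - Posz d)) _
  (fun j => q`_j) Posz (fun _ _ _ => lmonomD _ _ _)).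
Qed.

Lemma leval_ldivXn (R : realType) (q : {poly R}) (d : nat) (x : R) : x != 0 ->
  leval (ldivXn (laurent_of_poly q) d) x = q.[x] / x ^+ d.
Proof.
move=> nz_x; rewrite ldivXn_laurent_of_poly.
apply: (etrans (@sum_msupp_lmonom R R (fun y k => y * x ^ k) (size q)
  (fun j => q`_j) (fun j => Posz j - Posz d) (fun _ _ _ => mulrDl _ _ _))).
rewrite horner_coef mulr_suml; apply: eq_bigr => j _.
by rewrite expfzDr // -mulrA -exprnN.
Qed.

Lemma interpolatory_ldivXn (R : realType) (q : {poly R}) (d : nat) :
    q + (-1) ^+ d *: pneg q = 2%:P * 'X^d ->
  interpolatory_symbol (ldivXn (laurent_of_poly q) d).
Proof.
move=> qE; rewrite /interpolatory_symbol ldivXn_laurent_of_poly.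
have coefE j : q`_j * (1 + (-1) ^ (Posz j - Posz d)) = 2 * (j == d)%:R.
  have -> : (-1) ^ (Posz j - Posz d) = (-1) ^+ d * (-1) ^+ j :> R.
    by rewrite expfzDr ?oppr_eq0 ?oner_eq0 // mulrC -exprnN -exprVn invrN invr1.
  have := congr1 (fun r : {poly R} => r`_j) qE.
  rewrite coefD coefZ coef_pneg mul_polyC coefZ coefXn => <-.
  by ring.
have -> : lneg (\sum_(j < size q) lmonom q`_j (Posz j - Posz d)) =
    \sum_(j < size q)
      lmonom (q`_j * (-1) ^ (Posz j - Posz d)) (Posz j - Posz d).
  apply: (@sum_msupp_lmonom R _ (fun y k => lmonom (y * (-1) ^ k) k) (size q)
    (fun j => q`_j) (fun j => Posz j - Posz d)) => x y k.
  by rewrite mulrDl lmonomD.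
rewrite -big_split /=.
under eq_bigr => j _ do rewrite -lmonomD -[X in X + _]mulr1 -mulrDr coefE.
(* The coefficient of [z^d] in [q] is 1, so the term [j = d], which
   carries the whole sum, lies in the summation range. *)
have ltd: (d < size q)%N.
  rewrite ltnNge; apply/negP => /leq_sizeP/(_ d (leqnn d)) qd0.
  by have /eqP := coefE d; rewrite qd0 mul0r eqxx mulr1 eq_sym pnatr_eq0.
rewrite (bigD1 (Ordinal ltd)) //= eqxx mulr1 subrr big1 ?addr0 // => j nej.
have /negPf -> : (j : nat) != d.
  by apply: contraNneq nej => ejd; apply/eqP/val_inj.
by rewrite mulr0 /lmonom monalgU0.
Qed.

Theorem proposition2 (R : realType) (n : nat) (a : {poly R})
    (a_size : size a = n.+1)
    (a_coprime : coprimep a (pneg a))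
    (a_at1 : a.[1] = 2)
    (a_atN1 : a.[-1] = 0)
    (s : sign) (i : nat) (i_bounds : (1 <= i <= n)%N) :
  (exists! p : {poly R}, is_bezout_poly a n s i p) /\
  (forall p : {poly R}, is_bezout_poly a n s i p ->
     [/\ interpolatory_symbol (symbol a p s i),
         leval (symbol a p s i) 1 = 2
       & leval (symbol a p s i) (-1) = 0]).
Proof.
split.
  have [p pP] := is_bezout_poly_exists s a_size a_coprime i_bounds.
  exists p; split=> // q qP.
  exact: is_bezout_poly_unique a_size a_coprime pP qP.
move=> p [_]; rewrite star_ell -pnegM => qE; rewrite /symbol.
have /andP[i1 _] := i_bounds; rewrite -(sign_exponent R s i1) in qE.
set q := a * p in qE *; set d := (2 * i - ell s)%N in qE *.
have qN1: q.[-1] = 0 by rewrite hornerM a_atN1 mul0r.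
have q1: q.[1] = 2.
  have := congr1 (fun r : {poly R} => r.[1]) qE.
  rewrite mul_polyC !hornerE horner_pneg qN1 expr1n mulr0 addr0.
  by rewrite mulr1.
split; first exact: interpolatory_ldivXn.
  by rewrite leval_ldivXn ?oner_eq0 // expr1n divr1.
by rewrite leval_ldivXn ?oppr_eq0 ?oner_eq0 // qN1 mul0r.
Qed.
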